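(* Let $p$ be a prime and $m\ge 1$. The alternating forms graph $\mathrm{Alt}(5,p^m)$ is separating.
   Context: $\mathrm{Alt}(5,q)$ has as vertices the $5\times 5$ alternating matrices over $\mathbb{F}_q$ (skew-symmetric with zero diagonal), two matrices $A,B$ being adjacent if $\mathrm{rank}(A-B)=2$. A graph $\Gamma$ is separating if $\omega(\Gamma)\alpha(\Gamma)<|V(\Gamma)|$, where $\omega$ and $\alpha$ are the maximum clique and coclique sizes. *)

(* Defs.v *)
From HB Require Import structures.
From mathcomp Require Import all_boot all_order all_algebra.

Set Implicit Arguments.
Unset Strict Implicit.
Unset Printing Implicit Defensive.

Import GRing.Theory.
Local Open Scope ring_scope.

Record sgraph := SGraph {
  vertex : finType;
  adj : rel vertex;
  adj_sym : symmetric adj;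
  adj_irr : irreflexive adj
}.

Section CliquesCocliques.
Variable G : sgraph.

Definition is_clique (S : {set vertex G}) : bool :=
  [forall x in S, forall y in S, (x != y) ==> adj x y].

Definition is_coclique (S : {set vertex G}) : bool :=
  [forall x in S, forall y in S, ~~ adj x y].

Definition clique_number : nat := (\max_(S | is_clique S) #|S|)%N.

Definition coclique_number : nat := (\max_(S | is_coclique S) #|S|)%N.

Definition separating : Prop :=
  (clique_number * coclique_number < #|vertex G|)%N.

End CliquesCocliques.

Section AlternatingForms.
Variables (n : nat) (F : finFieldType).

(* The zero diagonal is not redundant in characteristic 2. *)
Definition alternating (A : 'M[F]_n) : bool :=
  (A^T == - A) && [forall i, A i i == 0].

Definition alt_matrix : finType := {A : 'M[F]_n | alternating A}.

Definition alt_adj : rel alt_matrix :=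
  fun A B => \rank (val A - val B) == 2%N.

Lemma alt_adj_sym : symmetric alt_adj.
Proof. by move=> A B; rewrite /alt_adj -opprB mxrank_opp. Qed.

Lemma alt_adj_irr : irreflexive alt_adj.
Proof. by move=> A; rewrite /alt_adj subrr mxrank0. Qed.

Definition Alt : sgraph := SGraph alt_adj_sym alt_adj_irr.

End AlternatingForms.

(* Main.v *)
(* The Pfaffians of order 4 vanish on the differences of a clique, and fixing one
   such difference reduces the clique to pairs of vectors of F^3 whose
   differences are parallel; hence a clique has at most q^4 elements. Two
   elements of a coclique that agree on a hyperplane are at rank distance at
   most 2, hence equal, so a coclique has at most q^6 elements. If it had
   exactly q^6, its restriction to every hyperplane would be a bijection onto
   all alternating forms, which a count modulo q^6 of the triples (x, y, B)
   with B(x, y) = 0 refutes: all nonzero forms involved have rank 4. So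
   omega * alpha < q^4 * q^6 = #|V|. *)
Require Import Defs.
From mathcomp Require Import all_boot all_order all_algebra.
From mathcomp Require Import mxabelem.
From mathcomp Require Import ring zify.

Set Implicit Arguments.
Unset Strict Implicit.
Unset Printing Implicit Defensive.

Import GRing.Theory.
Local Open Scope ring_scope.

(** * Alternating matrices and the parity of their rank *)

Lemma matrix_neq0 (R : nmodType) m n (A : 'M[R]_(m, n)) :
  A != 0 -> exists i j, A i j != 0.
Proof.
move=> nzA; suff /existsP[i /existsP[j]] : [exists i, exists j, A i j != 0].
  by exists i, j.
apply: contra_neqT nzA; rewrite negb_exists => /forallP A0.
apply/matrixP=> i j; rewrite mxE; apply/eqP.
by have:= A0 i; rewrite negb_exists => /forallP/(_ j); rewrite negbK.
Qed.

Section AlternatingMatrices.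
Variables (n : nat) (F : finFieldType).
Implicit Types A B D : 'M[F]_n.

Lemma alternating_skew A i j : alternating A -> A j i = - A i j.
Proof. by case/andP=> /eqP/matrixP/(_ i j); rewrite !mxE. Qed.

Lemma alternating_diag A i : alternating A -> A i i = 0.
Proof. by case/andP=> _ /forallP/(_ i)/eqP. Qed.

Lemma alternating_subtr (U : 'M[F]_n) : alternating (U - U^T).
Proof.
apply/andP; split; first by rewrite linearB /= trmxK opprB.
by apply/forallP=> i; rewrite !mxE subrr.
Qed.

(** The form [U - U^T] encodes skewness and the zero diagonal together, so closure properties reduce
    to matrix algebra in every characteristic. *)
Lemma alternating_subtrP A : alternating A -> exists U : 'M[F]_n, A = U - U^T.
Proof.
move=> altA; exists (\matrix_(i, j) if (i < j)%N then A i j else 0).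
apply/matrixP=> i j; rewrite !mxE; case: ltngtP => [_|_|/val_inj ->].
- by rewrite subr0.
- by rewrite sub0r (alternating_skew _ _ altA).
- by rewrite subrr alternating_diag.
Qed.

Lemma alternatingD A B : alternating A -> alternating B -> alternating (A + B).
Proof.
move=> /alternating_subtrP[U ->] /alternating_subtrP[V ->].
by rewrite addrACA -opprD -[U^T + V^T]raddfD alternating_subtr.
Qed.

Lemma alternatingN A : alternating A -> alternating (- A).
Proof.
by move=> /alternating_subtrP[U ->]; rewrite opprD -[X in _ - X]raddfN alternating_subtr.
Qed.

Lemma alternatingB A B : alternating A -> alternating B -> alternating (A - B).
Proof. by move=> altA altB; rewrite alternatingD ?alternatingN. Qed.

Lemma alternating_congr (P : 'M[F]_n) A :
  alternating A -> alternating (P *m A *m P^T).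
Proof.
move=> /alternating_subtrP[U ->]; rewrite mulmxBr mulmxBl.
have <- : (P *m U *m P^T)^T = P *m U^T *m P^T.
  by rewrite !trmx_mul trmxK mulmxA.
exact: alternating_subtr.
Qed.

(* Subtracting a hyperbolic plane spanned by rows i and j of A, where
   A i j != 0, leaves an alternating matrix of rank two less. *)
Lemma alternating_rank_even A : alternating A -> ~~ odd (\rank A).
Proof.
have [r] := ubnP (\rank A); elim: r A => // r IHr A ltAr altA.
have [-> | nzA] := eqVneq A 0; first by rewrite mxrank0.
have [i [j nzij]] := matrix_neq0 nzA.
have Aii := alternating_diag i altA; have Ajj := alternating_diag j altA.
have Aji : A j i = - A i j by apply: alternating_skew.
pose W : 'M[F]_n := (A i j)^-1 *: ((row j A)^T *m row i A).
pose A' := A + (W - W^T).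
have altA' : alternating A' by rewrite alternatingD ?alternating_subtr.
pose R := col_mx (row i A) (row j A).
have A'E k l : A' k l = A k l + (A i j)^-1 * (A j k * A i l - A i k * A j l).
  by rewrite !mxE !big_ord1 !mxE; ring.
have A'i k : A' k i = 0.
  rewrite A'E Aii Aji (alternating_skew i k altA); field; exact: nzij.
have A'j k : A' k j = 0.
  rewrite A'E Ajj (alternating_skew j k altA); field; exact: nzij.
have sub_i : (row i A <= R)%MS by rewrite /R -addsmxE addsmxSl.
have sub_j : (row j A <= R)%MS by rewrite /R -addsmxE addsmxSr.
have subW : (W - W^T <= R)%MS.
  rewrite addmx_sub ?eqmx_opp // ?scalemx_sub ?mulmx_sub //.
  by rewrite /W linearZ /= trmx_mul trmxK scalemx_sub ?mulmx_sub.
(* Vectors in the row space of [A'] vanish at coordinates [i] and [j], while these two coordinates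
   determine a combination of rows [i] and [j] of [A]. *)
have capR : (A' :&: R)%MS = 0.
  apply/eqP; rewrite -submx0; apply/rV_subP=> v; rewrite sub_capmx.
  case/andP=> /submxP[a ->] /submxP[b ab].
  have v0 k : (forall l, A' l k = 0) -> (a *m A') 0 k = 0.
    by move=> Ak; rewrite mxE big1 // => l _; rewrite Ak mulr0.
  have := v0 j A'j; have := v0 i A'i; rewrite ab -[b]hsubmxK mul_row_col.
  rewrite [lsubmx b]mx11_scalar [rsubmx b]mx11_scalar !mul_scalar_mx !mxE.
  rewrite Aii Ajj Aji !mulr0 add0r addr0 mulrN => /eqP.
  rewrite oppr_eq0 mulf_eq0 (negPf nzij) orbF => /eqP -> /eqP.
  rewrite mulf_eq0 (negPf nzij) orbF => /eqP ->.
  by rewrite !scale0r addr0 sub0mx.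
have rankR : \rank R = 2%N.
  apply/eqP/row_freeP.
  (* On columns [i] and [j], [R] is [A i j] times a signed permutation matrix, which this right
     inverse undoes. *)
  exists ((A i j)^-1 *: row_mx (delta_mx j 0) (- delta_mx i 0)).
  rewrite -scalemxAr mul_col_row !mulmxN -!colE scalar_mx_block.
  rewrite scale_block_mx; congr block_mx; apply/matrixP=> x y;
    rewrite [x]ord1 [y]ord1 !mxE ?eqxx /=.
  - by rewrite mulVf.
  - by rewrite Aii oppr0 mulr0.
  - by rewrite Ajj mulr0.
  - by rewrite Aji opprK mulVf.
have sRA : (R <= A)%MS by rewrite /R col_mx_sub !row_sub.
have rankA : \rank A = (\rank A' + 2)%N.
  rewrite -rankR -mxrank_disjoint_sum //; apply: eqmx_rank; apply/andP; split.
    rewrite -[X in (X <= _)%MS](addrK (W - W^T)) -/A' addmx_sub_adds //.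
    by rewrite eqmx_opp.
  by rewrite addsmx_sub sRA andbT addmx_sub // (submx_trans subW).
rewrite rankA oddD addbF; apply: IHr altA'.
by rewrite rankA in ltAr; lia.
Qed.

End AlternatingMatrices.

(** * Pfaffians of order 4 *)

Section Pfaffian.
Variables (n : nat) (F : finFieldType).
Implicit Types A B D : 'M[F]_n.

Definition pfaffian D (i j k l : 'I_n) : F :=
  D i j * D k l - D i k * D j l + D i l * D j k.

(** A rank factorization through dimension 2 turns the vanishing of the 3 x 3 minors into a
    polynomial identity. *)
Lemma minor3_rank2 (D : 'M[F]_n) i j k i' j' k' : \rank D = 2%N ->
  D i i' * (D j j' * D k k' - D j k' * D k j')
  - D i j' * (D j i' * D k k' - D j k' * D k i')
  + D i k' * (D j i' * D k j' - D j j' * D k i') = 0.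
Proof.
move=> rkD; have:= mulmx_base D; move: (col_base D) (row_base D).
rewrite rkD => X Y <-; rewrite !mxE !big_ord_recl !big_ord0 !addr0; ring.
Qed.

Lemma pfaffian_rank2 D i j k l :
  alternating D -> \rank D = 2%N -> pfaffian D i j k l = 0.
Proof.
move=> altD rkD; have skew := alternating_skew _ _ altD.
have diag a : D a a = 0 by apply: alternating_diag.
(* D i j * pfaffian is the minor on rows i, j, k and columns i, j, l. *)
have pfD : D i j * pfaffian D i j k l = 0.
  rewrite -(minor3_rank2 i j k i j l rkD) /pfaffian.
  rewrite (skew i j) (skew i k) (skew j k) !diag; ring.
have pfD' : D i k * pfaffian D i j k l = 0.
  rewrite -oppr0 -(minor3_rank2 i k j i k l rkD) /pfaffian.
  rewrite (skew i k) (skew i j) !diag; ring.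
have pfD'' : D i l * pfaffian D i j k l = 0.
  rewrite -(minor3_rank2 i l j i l k rkD) /pfaffian.
  rewrite (skew i l) (skew i j) (skew k l) !diag; ring.
(* The Pfaffian is itself a combination of [D i j], [D i k] and [D i l], so its square vanishes. *)
have: pfaffian D i j k l * pfaffian D i j k l = 0.
  transitivity (D i j * pfaffian D i j k l * D k l
    - D i k * pfaffian D i j k l * D j l + D i l * pfaffian D i j k l * D j k).
    by rewrite /pfaffian; ring.
  by rewrite pfD pfD' pfD'' !mul0r subrr addr0.
by move/eqP; rewrite mulf_eq0 orbb => /eqP.
Qed.

End Pfaffian.

(** * Pairs of vectors with parallel differences *)

Section ParallelPairs.
Variables (T : finType) (F : finFieldType).

Let parallel (u v : {ffun T -> F}) := forall i j, u i * v j = u j * v i.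

Lemma ffunB_neq0 (u v : {ffun T -> F}) : u != v -> exists k, u k - v k != 0.
Proof.
move=> neq_uv; apply/existsP; apply: contra_neqT neq_uv.
rewrite negb_exists => /forallP uv; apply/ffunP=> k.
by apply/eqP; rewrite -subr_eq0 -[_ == _]negbK uv.
Qed.

(* If neither coordinate is injective on S, there are two pairs of points of S
   differing by some (v, 0) and by some (0, w), which confines S to a coset of
   a product of two lines. *)
Lemma card_parallel_pairs (S : {set {ffun T -> F} * {ffun T -> F}}) :
    (1 < #|T|)%N ->
    (forall z z', z \in S -> z' \in S -> parallel (z.1 - z'.1) (z.2 - z'.2)) ->
  (#|S| <= #|F| ^ #|T|)%N.
Proof.
move=> T_gt1 parS.
have [inj1 | ninj1] := boolP [forall z in S, forall z' in S,
    (z.1 == z'.1) ==> (z == z')].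
  rewrite -card_ffun; apply: (@leq_card_in _ _ fst) => z z' Sz Sz' /eqP eqz.
  have /forall_inP/(_ z Sz)/forall_inP/(_ z' Sz') := inj1.
  by rewrite eqz => /eqP.
have [inj2 | ninj2] := boolP [forall z in S, forall z' in S,
    (z.2 == z'.2) ==> (z == z')].
  rewrite -card_ffun; apply: (@leq_card_in _ _ snd) => z z' Sz Sz' /eqP eqz.
  have /forall_inP/(_ z Sz)/forall_inP/(_ z' Sz') := inj2.
  by rewrite eqz => /eqP.
have [q1 [q2 [Sq1 Sq2 q12 /ffunB_neq0[b wb]]]] : exists z z',
    [/\ z \in S, z' \in S, z.1 = z'.1 & z.2 != z'.2].
  have /forall_inPn[[z1 z2] Sz /forall_inPn[[z1' z2'] Sz']] := ninj1.
  rewrite negb_imply /= => /andP[/eqP eqz neqz].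
  exists (z1, z2), (z1', z2'); split=> //=.
  by apply: contraNneq neqz => eqz2; rewrite eqz eqz2.
have [p1 [p2 [Sp1 Sp2 p12 /ffunB_neq0[a va]]]] : exists z z',
    [/\ z \in S, z' \in S, z.2 = z'.2 & z.1 != z'.1].
  have /forall_inPn[[z1 z2] Sz /forall_inPn[[z1' z2'] Sz']] := ninj2.
  rewrite negb_imply /= => /andP[/eqP eqz neqz].
  exists (z1, z2), (z1', z2'); split=> //=.
  by apply: contraNneq neqz => eqz1; rewrite eqz eqz1.
apply: leq_trans (_ : #|{: F * F}| <= _)%N; last first.
  by rewrite card_prod mulnn leq_pexp2l // ltnW // card_finNzRing_gt1.
(* Since [p1] and [p2] share their second component, subtracting the two parallelism relations puts
   [z.2] on the line through [p1.2] with direction [p1.1 - p2.1]. *)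
have S2 z k : z \in S ->
  (p1.1 a - p2.1 a) * (z.2 k - p1.2 k) = (p1.1 k - p2.1 k) * (z.2 a - p1.2 a).
  move=> Sz; have:= parS _ _ Sz Sp1 a k; have:= parS _ _ Sz Sp2 a k.
  rewrite -p12 !ffunE => e2 e1.
  apply/eqP; rewrite -subr_eq0; apply/eqP.
  move/eqP: e1; rewrite -subr_eq0 => /eqP e1.
  move/eqP: e2; rewrite -subr_eq0 => /eqP e2.
  by rewrite -[RHS](subrr 0) -{1}e2 -e1; ring.
have S1 z k : z \in S ->
  (q1.2 b - q2.2 b) * (z.1 k - q1.1 k) = (q1.2 k - q2.2 k) * (z.1 b - q1.1 b).
  move=> Sz; have:= parS _ _ Sz Sq1 b k; have:= parS _ _ Sz Sq2 b k.
  rewrite -q12 !ffunE => e2 e1.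
  apply/eqP; rewrite -subr_eq0; apply/eqP.
  move/eqP: e1; rewrite -subr_eq0 => /eqP e1.
  move/eqP: e2; rewrite -subr_eq0 => /eqP e2.
  by rewrite -[RHS](subrr 0) -{1}e1 -e2; ring.
pose f (z : {ffun T -> F} * {ffun T -> F}) := (z.1 b, z.2 a).
apply: (@leq_card_in _ _ f) => z z' Sz Sz' [ez1 ez2].
rewrite [z]surjective_pairing [z']surjective_pairing.
congr pair; apply/ffunP=> k.
  have:= S1 z k Sz; rewrite ez1 -(S1 z' k Sz') => /(mulfI wb).
  exact: addIr.
have:= S2 z k Sz; rewrite ez2 -(S2 z' k Sz') => /(mulfI va).
exact: addIr.
Qed.

End ParallelPairs.

(** * Cliques *)

(** One factor q accounts for the entry [B i j], and q^(n-2) for the pair of reduced rows, indexed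
    by the n-2 remaining indices. *)
Lemma card_clique n (F : finFieldType) (S : {set alt_matrix n F}) :
  (3 < n)%N -> is_clique (G := Alt n F) S -> (#|S| <= #|F| ^ n.-1)%N.
Proof.
move=> n_gt3 cliqueS; have F_gt0 : (0 < #|F|)%N := ltnW (card_finNzRing_gt1 F).
have [S_le1 | /card_gt1P[A1 [A0 [SA1 SA0 neqA]]]] := leqP #|S| 1%N.
  by rewrite (leq_trans S_le1) ?expn_gt0 ?F_gt0.
have alt2 (B B' : alt_matrix n F) : alternating (val B - val B').
  by rewrite alternatingB ?(valP B) ?(valP B').
have pf0 B B' i j k l :
    B \in S -> B' \in S -> pfaffian (val B - val B') i j k l = 0.
  move=> SB SB'; have [-> | neqB] := eqVneq B B'.
    by rewrite subrr /pfaffian !mxE; ring.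
  apply: pfaffian_rank2 => //; apply/eqP.
  by have /forall_inP/(_ B SB)/forall_inP/(_ B' SB') := cliqueS; rewrite neqB.
pose A := val A1 - val A0.
have altA : alternating A by apply: alt2.
have nzA : A != 0 by rewrite subr_eq0.
have [i [j a_neq0]] := matrix_neq0 nzA.
have neq_ij : i != j.
  by apply: contraNneq a_neq0 => ->; rewrite alternating_diag.
(* The polar form of the Pfaffian vanishes at (A, B - B') because the Pfaffian
   vanishes on all four differences between {A1, A0} and {B, B'}. *)
have polar B B' k l : B \in S -> B' \in S ->
    A i j * (val B - val B') k l + (val B - val B') i j * A k l
    - (A i k * (val B - val B') j l + (val B - val B') i k * A j l)
    + (A i l * (val B - val B') j k + (val B - val B') i l * A j k) = 0.
  move=> SB SB'.
  transitivity (pfaffian (val A1 - val B') i j k l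
    + pfaffian (val A0 - val B) i j k l - pfaffian (val A1 - val B) i j k l
    - pfaffian (val A0 - val B') i j k l).
    by rewrite /pfaffian !mxE; ring.
  by rewrite !pf0 // !subr0 addr0.
pose T := {k : 'I_n | (k != i) && (k != j)}.
have cardT : #|{: T}| = n.-2.
  rewrite card_sig; have := cardC (pred2 i j).
  rewrite card2 neq_ij card_ord add2n => /(congr1 (fun m => m.-2)) <- /=.
  apply: eq_card => k.
  by rewrite !inE negb_or.
(* Rows i and j, reduced modulo A: since the Pfaffian and its polar form
   vanish, they are parallel, and with B i j they determine B. *)
pose r (B : 'M[F]_n) := [ffun k : T => A i j * B i (val k) - A i (val k) * B i j].
pose s (B : 'M[F]_n) := [ffun k : T => A i j * B j (val k) - A j (val k) * B i j].
have parS z z' : z \in [set (r (val B), s (val B)) | B in S] ->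
    z' \in [set (r (val B), s (val B)) | B in S] ->
    forall k l, (z.1 - z'.1) k * (z.2 - z'.2) l = (z.1 - z'.1) l * (z.2 - z'.2) k.
  case/imsetP=> B SB -> /imsetP[B' SB' ->] k l /=.
  have pA := pf0 A1 A0 i j (val k) (val l) SA1 SA0.
  have pD := pf0 B B' i j (val k) (val l) SB SB'.
  have bAD := polar B B' (val k) (val l) SB SB'.
  rewrite !ffunE; apply/eqP; rewrite -subr_eq0; apply/eqP.
  pose d := (val B - val B') i j.
  (* With D = B - B', the differences of [r] and [s] are entries of rows [i] and [j] of E = [A i j]
     D - [d] A. As E vanishes at (i, j), its Pfaffian is minus the required minor; the zeros stand
     for the polar form and the Pfaffians of D and A in its expansion. *)
  transitivity (A i j * d * 0 - A i j ^+ 2 * 0 - d ^+ 2 * 0); last by ring.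
  rewrite -{1}bAD -{1}pD -pA /pfaffian /d -/A !mxE; ring.
have T_gt1 : (1 < #|{: T}|)%N by rewrite cardT; lia.
have := card_parallel_pairs T_gt1 parS; rewrite cardT => cardS'.
have -> : n.-1 = n.-2.+1 by lia.
rewrite expnS (leq_trans _ (leq_mul (leqnn _) cardS')) // -cardsT -cardsX.
pose f (B : alt_matrix n F) := ((val B) i j, (r (val B), s (val B))).
rewrite -(@card_in_imset _ _ f) => [|B B' SB SB' [eij er es]].
  apply/subset_leq_card/subsetP=> _ /imsetP[B SB ->].
  by rewrite in_setX in_setT; apply/imsetP; exists B.
have dij : (val B - val B') i j = 0 by rewrite !mxE eij subrr.
have dji : (val B - val B') j i = 0.
  by rewrite (alternating_skew i j (alt2 B B')) dij oppr0.
have di k : (val B - val B') i k = 0.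
  have [-> | nki] := eqVneq k i; first exact: alternating_diag.
  have [-> // | nkj] := eqVneq k j.
  have kT : (k != i) && (k != j) by rewrite nki.
  have /ffunP/(_ (exist _ k kT)) := er.
  rewrite !ffunE /= eij => /addIr/(mulfI a_neq0) e.
  by rewrite !mxE e subrr.
have dj k : (val B - val B') j k = 0.
  have [-> | nkj] := eqVneq k j; first exact: alternating_diag.
  have [-> // | nki] := eqVneq k i.
  have kT : (k != i) && (k != j) by rewrite nki.
  have /ffunP/(_ (exist _ k kT)) := es.
  rewrite !ffunE /= eij => /addIr/(mulfI a_neq0) e.
  by rewrite !mxE e subrr.
apply/val_inj/eqP; rewrite -subr_eq0; apply/eqP/matrixP=> k l.
(* Once rows [i] and [j] of the difference vanish, the polar identity retains only its first
   term. *)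
have := polar B B' k l SB SB'; rewrite !di !dj !(mul0r, mulr0, addr0, subr0).
by move/eqP; rewrite mulf_eq0 (negPf a_neq0) => /eqP ->; rewrite mxE.
Qed.

(** * The number of vertices *)

(** The entries above the diagonal can be prescribed freely. *)
Lemma card_alt_matrix_ge n (F : finFieldType) :
  (#|F| ^ 'C(n, 2) <= #|alt_matrix n F|)%N.
Proof.
pose T := {ij : 'I_n * 'I_n | (ij.1 < ij.2)%N}.
have <- : #|{: T}| = 'C(n, 2).
  rewrite card_sig -sum1_card -(pair_big_dep xpredT (fun i j : 'I_n => i < j)%N (fun _ _ => 1%N)) /=.
  rewrite (exchange_big_dep xpredT) //= -bin2_sum big_mkord.
  apply: eq_bigr => j _; rewrite -(big_ord_widen n (fun=> 1%N)) ?sum1_card ?card_ord //.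
  exact: ltnW.
pose U (h : {ffun T -> F}) : 'M[F]_n :=
  \matrix_(i, j) if insub (i, j) is Some t then h t else 0.
pose f h : alt_matrix n F := Sub (U h - (U h)^T) (alternating_subtr (U h)).
rewrite -card_ffun; apply: (@leq_card _ _ f) => h h' /(congr1 val)/= /matrixP fh.
apply/ffunP=> -[[i j] ltij]; have := fh i j.
rewrite !mxE (insubT (fun ij : 'I_n * 'I_n => ij.1 < ij.2)%N ltij) insubF ?subr0 //=.
by rewrite ltnNge ltnW.
Qed.

(** * Kernels, changes of basis and fibers *)

Lemma card_ker_rV (F : finFieldType) m n (M : 'M[F]_(m, n)) :
  #|[set x : 'rV_m | x *m M == 0]| = (#|F| ^ (m - \rank M))%N.
Proof.
rewrite -mxrank_ker -card_rowg; apply: eq_card => x.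
by rewrite !inE; apply/eqP/sub_kermxP.
Qed.

(** This makes the value B(x, y) at an independent pair an entry of P B P^T. *)
Lemma unitmx_extend2 (F : fieldType) n (x y : 'rV[F]_n.+2) :
    x != 0 -> ~~ (y <= x)%MS ->
  exists P, [/\ P \in unitmx, row 0 P = x & row 1 P = y].
Proof.
move=> nzx indep_y.
pose U : 'M[F]_(1 + 1, n.+2) := col_mx (delta_mx 0 0) (delta_mx 0 1).
have UUt : U *m U^T = 1%:M.
  rewrite /U tr_col_mx !trmx_delta mul_col_row !mul_delta_mx !mul_delta_mx_0 //.
  by rewrite scalar_mx_block; congr block_mx; apply/matrixP=> i j; rewrite !mxE !ord1.
have rkU : \rank U = 2%N by apply/eqP/row_freeP; exists U^T.
have rkxy : \rank (col_mx x y) = 2%N.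
  apply/eqP; rewrite eqn_leq rank_leq_row -addsmxE.
  have : (x < x + y)%MS by rewrite ltmxE addsmxSl addsmx_sub submx_refl.
  by move/rank_ltmx; rewrite rank_rV nzx.
(* The map [U^T *m col_mx x y] sends the first two unit vectors to [x] and [y]; an invertible map
   agrees with it on their span. *)
have [|P uP] := @complete_unitmx _ _ _ U (U^T *m col_mx x y).
  by rewrite mulmxA UUt mul1mx rkU.
rewrite mulmxA UUt mul1mx mul_col_mx -!rowE => /eq_col_mx[ex ey].
by exists P.
Qed.

Lemma mulmx_row_entry (F : fieldType) n (P B : 'M[F]_n) i j :
  (P *m B *m P^T) i j = (row i P *m B *m (row j P)^T) 0 0.
Proof. by rewrite -row_mul !mxE; apply: eq_bigr => k _; rewrite !mxE. Qed.

Lemma alternating_isotropic (F : finFieldType) n (D : 'M[F]_n) (x : 'rV_n) :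
  alternating D -> x *m D *m x^T = 0.
Proof.
case/alternating_subtrP=> U ->; rewrite mulmxBr mulmxBl.
apply/eqP; rewrite subr_eq0; apply/eqP.
have -> : x *m U^T *m x^T = (x *m U *m x^T)^T.
  by rewrite !trmx_mul trmxK mulmxA.
by rewrite [x *m U *m x^T]mx11_scalar tr_scalar_mx.
Qed.

(** Every row but row [k] is a multiple of the [k]-th unit vector. Differences of forms that agree
    on a coordinate hyperplane have this shape. *)
Lemma rank_le2_cross (F : fieldType) n (D : 'M[F]_n) k :
  (forall i j, i != k -> j != k -> D i j = 0) -> (\rank D <= 2)%N.
Proof.
move=> D0; have sD : (D <= row k D + (delta_mx 0 k : 'rV_n))%MS.
  apply/row_subP=> i; have [-> | nik] := eqVneq i k; first exact: addsmxSl.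
  apply: submx_trans (addsmxSr _ _).
  suff -> : row i D = D i k *: delta_mx 0 k by rewrite scalemx_sub.
  apply/rowP=> j; rewrite !mxE eqxx /=; have [-> | njk] := eqVneq j k.
    by rewrite mulr1.
  by rewrite mulr0 D0.
apply: leq_trans (mxrankS sD) _; apply: leq_trans (mxrank_adds_leqif _ _) _.
by apply: (@leq_add _ _ 1 1); apply: rank_leq_row.
Qed.

(** By cardinality the injection is onto [A * B]. *)
Lemma card_fst_fiber (X A B : finType) (f : X -> A * B) (Y : {set X}) c :
    {in Y &, injective f} -> #|Y| = (#|A| * #|B|)%N ->
  #|[set y in Y | (f y).1 == c]| = #|B|.
Proof.
move=> injf cardY.
have fY : f @: Y = [set: A * B].
  apply/eqP; rewrite eqEcard subsetT cardsT card_prod.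
  by rewrite card_in_imset // cardY leqnn.
rewrite -(@card_in_imset _ _ f); last first.
  by move=> y z; rewrite !inE => /andP[Yy _] /andP[Yz _]; apply: injf.
have -> : f @: [set y in Y | (f y).1 == c] = setX [set c] [set: B].
  apply/setP=> -[a b]; rewrite !inE andbT /=; apply/imsetP/eqP => [[y]|->].
    by rewrite inE => /andP[_ /eqP <-] <-.
  have /imsetP[y Yy ey] : (c, b) \in f @: Y by rewrite fY inE.
  by exists y; rewrite // inE Yy -ey /=.
by rewrite cardsX cards1 mul1n cardsT.
Qed.

(** * Cocliques *)

Section Coclique.
Variables (F : finFieldType) (Y : {set alt_matrix 5 F}).
Hypothesis cocliqueY : is_coclique (G := Alt 5 F) Y.

Let q := #|F|.

(** The rank is even, nonzero, at most 5, and differs from 2 by nonadjacency. *)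
Lemma coclique_rank A B :
  A \in Y -> B \in Y -> A != B -> \rank (val A - val B) = 4%N.
Proof.
move=> YA YB neqAB.
have /forall_inP/(_ A YA)/forall_inP/(_ B YB) := cocliqueY.
have := alternating_rank_even (alternatingB (valP A) (valP B)).
have : \rank (val A - val B) != 0%N by rewrite mxrank_eq0 subr_eq0.
have := rank_leq_row (val A - val B); rewrite /= /alt_adj.
by move: (\rank _) => [|[|[|[|[|[|r]]]]]].
Qed.

(** These six entries describe the restriction of [B] to the hyperplane spanned by the first four
    rows of [P]; the (0, 1) entry stands apart so that its fibers can be counted. *)
Let corner (P : 'M[F]_5) (B : alt_matrix 5 F) :=
  let M := P *m val B *m P^T in
  let m i j := M (inord i) (inord j) in
  (m 0 1, (m 0 2, m 0 3, m 1 2, m 1 3, m 2 3))%N.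

Lemma corner_inj P : P \in unitmx -> {in Y &, injective (corner P)}.
Proof.
move=> uP A B YA YB eqAB; apply/eqP/negPn/negP=> neqAB.
have altD := alternating_congr P (alternatingB (valP A) (valP B)).
have := coclique_rank YA YB neqAB.
have uPt : row_free P^T by rewrite row_free_unit unitmx_tr.
have /eqmxMfull eqPA : row_full P by rewrite row_full_unit.
rewrite -(eqPA _ (val A - val B)) -(mxrankMfree _ uPt) => rk4.
suff : (\rank (P *m (val A - val B) *m P^T) <= 2)%N by rewrite rk4.
have D0 k l : (k < l < 4)%N ->
    (P *m (val A - val B) *m P^T) (inord k) (inord l) = 0.
  rewrite mulmxBr mulmxBl [LHS]mxE [X in _ + X]mxE => kl.
  apply/eqP; rewrite subr_eq0.
  move: eqAB; rewrite /corner.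
  move: (P *m val A *m P^T) (P *m val B *m P^T) => M M' [e01 e02 e03 e12 e13 e23].
  apply/eqP.
  by case/andP: kl; move: k l => [|[|[|k]]] [|[|[|[|l]]]].
move: (P *m (val A - val B) *m P^T) altD D0 => D altD D0.
apply: (@rank_le2_cross _ _ _ (inord 4)) => i j ni nj.
have lt4 (k : 'I_5) : k != inord 4 -> (k < 4)%N.
  by have := ltn_ord k; rewrite -val_eqE /= inordK //; lia.
rewrite -(inord_val i) -(inord_val j).
case: (ltngtP i j) => [lij | lji | /val_inj ->].
- by rewrite D0 ?lij ?lt4.
- by rewrite (alternating_skew _ _ altD) D0 ?oppr0 ?lji ?lt4.
- exact: alternating_diag.
Qed.

Lemma card_coclique_le : (#|Y| <= q ^ 6)%N.
Proof.
have <- : #|{: F * (F * F * F * F * F)}| = (q ^ 6)%N.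
  by rewrite !card_prod -/q !expnS expn0; lia.
exact: leq_card_in (corner_inj (unitmx1 _ _)).
Qed.

(** At cardinality q^6 the corner map is bijective, so each of its entries is equidistributed over
    [F]. *)
Lemma card_coclique_indep (x y : 'rV[F]_5) c :
    #|Y| = (q ^ 6)%N -> x != 0 -> ~~ (y <= x)%MS ->
  #|[set B in Y | (x *m val B *m y^T) 0 0 == c]| = (q ^ 5)%N.
Proof.
move=> cardY nzx indep_y; have [P [uP rowP0 rowP1]] := unitmx_extend2 nzx indep_y.
have F5 : #|{: F * F * F * F * F}| = (q ^ 5)%N.
  by rewrite !card_prod -/q !expnS expn0; lia.
rewrite -F5 -(card_fst_fiber c (corner_inj uP)) ?cardY ?F5 ?expnS //.
have i0 : inord 0 = 0 :> 'I_5 by apply: val_inj; rewrite /= inordK.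
have i1 : inord 1 = 1 :> 'I_5 by apply: val_inj; rewrite /= inordK.
by apply: eq_card => B; rewrite !inE /= i0 i1 mulmx_row_entry rowP0 rowP1.
Qed.

(* Count the triples (x, y, B) with B in Y and x (B - A0) y^T = 0 modulo q^6:
   summing over B first gives 0, summing over (x, y) first gives q^5. *)
Lemma card_coclique_neq : #|Y| <> (q ^ 6)%N.
Proof.
move=> cardY; have q_gt1 : (1 < q)%N := card_finNzRing_gt1 F.
have /card_gt0P[A0 YA0] : (0 < #|Y|)%N by rewrite cardY expn_gt0 ltnW.
have cardV : #|'rV[F]_5| = (q ^ 5)%N by rewrite card_mx mul1n.
pose D (B : alt_matrix 5 F) := val B - val A0.
have altD B : alternating (D B) := alternatingB (valP B) (valP A0).
pose N (x y : 'rV[F]_5) := #|[set B in Y | x *m D B *m y^T == 0]|.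
have N_full x y : (forall B, x *m D B *m y^T = 0) -> N x y = (q ^ 6)%N.
  by move=> xy0; rewrite -cardY; apply: eq_card => B; rewrite inE xy0 eqxx andbT.
have dvdN x : (q ^ 6 %| \sum_y N x y)%N.
  have [-> | nzx] := eqVneq x 0.
    by apply: dvdn_sum => y _; rewrite N_full // => B; rewrite !mul0mx.
  rewrite (bigID (fun y => y <= x)%MS) /= dvdn_add //.
    apply: dvdn_sum => y /sub_rVP[a ->]; rewrite N_full // => B.
    by rewrite linearZ -scalemxAr alternating_isotropic ?scaler0.
  (* Each of the q^5 - q vectors [y] independent of [x] contributes q^5, in total q^6 (q^4 - 1). *)
  rewrite (eq_bigr (fun=> q ^ 5)%N) => [|y indep_y]; last first.
    rewrite -(card_coclique_indep ((x *m val A0 *m y^T) 0 0) cardY nzx indep_y).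
    apply: eq_card => B; rewrite !inE; congr andb.
    rewrite mulmxBr mulmxBl subr_eq0; apply/eqP/eqP=> [-> // | exy].
    by apply/matrixP=> i j; rewrite [i]ord1 [j]ord1.
  rewrite sum_nat_const.
  have := cardC (fun y : 'rV[F]_5 => (y <= x)%MS).
  have -> : #|(fun y : 'rV[F]_5 => (y <= x)%MS)| = q.
    transitivity #|rowg x|; last by rewrite card_rowg rank_rV nzx expn1.
    by apply: eq_card => y; rewrite inE.
  rewrite cardV => cardC_x.
  have -> : #|(fun y : 'rV[F]_5 => ~~ (y <= x)%MS)| = (q * (q ^ 4 - 1))%N.
    by rewrite mulnBr -expnS muln1 -cardC_x addKn; apply: eq_card.
  by rewrite mulnAC -expnS dvdn_mulr.
pose K (x : 'rV[F]_5) B := #|[set y : 'rV[F]_5 | x *m D B *m y^T == 0]|.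
have sumN : (\sum_x \sum_y N x y = \sum_(B in Y) \sum_x K x B)%N.
  rewrite [RHS]exchange_big /=; apply: eq_bigr => x _.
  transitivity (\sum_(y : 'rV[F]_5) \sum_(B in Y) (x *m D B *m y^T == 0)%R)%N.
    apply: eq_bigr => y _; rewrite /N -sum1_card big_mkcond [RHS]big_mkcond.
    by apply: eq_bigr => B _; rewrite inE; case: (B \in Y); case: (_ == 0).
  rewrite exchange_big /=; apply: eq_bigr => B _.
  rewrite /K -sum1_card [RHS]big_mkcond; apply: eq_bigr => y _.
  by rewrite inE; case: (_ == 0).
have cardy (w : 'rV[F]_5) :
    #|[set y : 'rV_5 | w *m y^T == 0]| = (q ^ (5 - (w != 0%R)))%N.
  rewrite -rank_rV -mxrank_tr -card_ker_rV; apply: eq_card => y.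
  by rewrite !inE -[RHS]trmx_eq0 trmx_mul trmxK.
have sumA0 : (\sum_x K x A0 = q ^ 10)%N.
  rewrite (eq_bigr (fun=> q ^ 5)%N) => [|x _]; last first.
    by rewrite /K cardy /D subrr mulmx0 eqxx.
  by rewrite sum_nat_const cardV -expnD.
(* The form [D B] has rank 4, so its radical has q vectors, each orthogonal to all q^5 vectors; any
   other [x] is orthogonal to q^4. *)
have sumB B : B \in Y :\ A0 ->
    (\sum_x K x B = q ^ 6 + q * (q ^ 4 - 1) * q ^ 4)%N.
  case/setD1P=> neqB YB.
  have cardker : #|[set x : 'rV_5 | x *m D B == 0]| = q.
    by rewrite card_ker_rV coclique_rank // expn1.
  rewrite (bigID (fun x => x \in [set x : 'rV_5 | x *m D B == 0])) /=; congr addn.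
    rewrite (eq_bigr (fun=> q ^ 5)%N) => [|x]; last first.
      by rewrite /K inE cardy => ->.
    by rewrite sum_nat_const cardker -expnS.
  rewrite (eq_bigr (fun=> q ^ 4)%N) => [|x]; last first.
    by rewrite /K inE cardy => ->.
  rewrite sum_nat_const; congr muln.
  have := cardC [set x : 'rV_5 | x *m D B == 0]; rewrite cardker cardV => e.
  by rewrite mulnBr -expnS muln1 -e addKn; apply: eq_card.
have : (q ^ 6 %| \sum_x \sum_y N x y)%N by apply: dvdn_sum.
rewrite sumN (big_setD1 A0) //= sumA0 (eq_bigr _ sumB) sum_nat_const.
have cardYA0 : #|Y :\ A0| = (q ^ 6 - 1)%N.
  by have := cardsD1 A0 Y; rewrite YA0 cardY => ->; rewrite addKn.
have -> : (q * (q ^ 4 - 1) * q ^ 4 = q ^ 9 - q ^ 5)%N.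
  by rewrite mulnAC -expnS mulnBr muln1 -expnD.
(* As q^6 divides q^10 and is coprime to q^6 - 1, it would divide q^6 + q^9 - q^5, hence q^5. *)
rewrite cardYA0 dvdn_addr ?dvdn_exp2l // Gauss_dvdr; last first.
  by rewrite subn1 coprimenP // expn_gt0 (ltnW q_gt1).
rewrite dvdn_addr // dvdn_subr ?leq_exp2l //; last exact: dvdn_exp2l.
by rewrite dvdn_Pexp2l.
Qed.

End Coclique.

(** * Separation *)

Theorem theorem3p13 (p m : nat) (p_prime : prime p) (m_ge1 : (1 <= m)%N)
    (F : finFieldType) (F_card : #|F| = (p ^ m)%N) :
  separating (Alt 5 F).
Proof.
have F_gt0 : (0 < #|F|)%N := ltnW (card_finNzRing_gt1 F).
have clique_le : (clique_number (Alt 5 F) <= #|F| ^ 4)%N.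
  by apply/bigmax_leqP=> S cliqueS; apply: card_clique.
have coclique_lt : (coclique_number (Alt 5 F) < #|F| ^ 6)%N.
  (* The strict bound is restated as a weak one by the predecessor, so that it passes to the
     maximum. *)
  rewrite -[X in (_ < X)%N]prednK ?expn_gt0 ?F_gt0 // ltnS.
  apply/bigmax_leqP=> S cocliqueS; rewrite -ltnS prednK ?expn_gt0 ?F_gt0 //.
  rewrite ltn_neqAle card_coclique_le // andbT; apply/eqP.
  exact: card_coclique_neq.
apply: leq_trans (card_alt_matrix_ge 5 F); rewrite (_ : 'C(5, 2) = 4 + 6)%N // expnD.
apply: leq_ltn_trans (leq_mul clique_le (leqnn _)) _.
by rewrite ltn_pmul2l ?expn_gt0 ?F_gt0.
Qed.
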